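(* Let $V$ be a finite-dimensional complex vector space and $F\colon V\to\mathbb{R}$ a function such that $V_{\le r}=\{T\in V:F(T)\le r\}$ is Zariski-closed for all $r\in\mathbb{R}$. Let $V_{=r}=\{T\in V:F(T)=r\}$. The following are equivalent: (a) $\{F(T):T\in V\}$ is discrete from below, i.e., every non-decreasing sequence of elements of this set is eventually constant; (b) for every $r\in\mathbb{R}$, $V_{=r}$ is Zariski-open in $V_{\le r}$ (with the subspace topology). *)

(* Defs.v *)
From HB Require Import structures.
From mathcomp Require Import all_boot all_order all_algebra.
From mathcomp Require Import mpoly.
From mathcomp Require Import boolp classical_sets reals topology sequences.

Set Implicit Arguments.
Unset Strict Implicit.
Unset Printing Implicit Defensive.

Import Order.TTheory GRing.Theory Num.Theory.

Local Open Scope classical_set_scope.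
Local Open Scope ring_scope.

Section Zariski.
Variables (K : fieldType) (V : vectType K).

(* Polynomial functions on V are polynomials in the coordinates with respect to
   the library's basis of V; the resulting set of functions V -> K does not
   depend on the basis, since coordinate changes are linear. *)
Definition polyfun (p : {mpoly K[\dim {:V}]}) (v : V) : K :=
  p.@[fun i => coord (vbasis {:V}) i v].

Definition zero_locus (S : set {mpoly K[\dim {:V}]}) : set V :=
  [set v | forall p, S p -> polyfun p v = 0].

Definition zariski_open (U : set V) : Prop :=
  exists S, ~` U = zero_locus S.

(* A copy of V carrying the Zariski topology. *)
Definition zariski : Type := V.

HB.instance Definition _ := Choice.on zariski.

Lemma zariski_openT : zariski_open setT.
Proof.
exists [set 1]; rewrite setCT; apply/seteqP; split=> // v /(_ 1 erefl).
by rewrite /polyfun meval1 => /eqP; rewrite oner_eq0.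
Qed.

Lemma zariski_openI (A B : set V) :
  zariski_open A -> zariski_open B -> zariski_open (A `&` B).
Proof.
move=> [S SE] [T TE].
exists [set r | exists p q, [/\ S p, T q & r = p * q]].
rewrite setCI SE TE; apply/seteqP; split=> v.
  move=> vST _ [p [q [Sp Tq ->]]]; rewrite /polyfun mevalM.
  case: vST => [/(_ p Sp)|/(_ q Tq)]; rewrite /polyfun => ->.
    by rewrite mul0r.
  by rewrite mulr0.
move=> vST; have [|/existsNP[p /not_implyP[Sp /eqP pv]]] := pselect (zero_locus S v).
  by left.
right=> q Tq; have : polyfun (p * q) v = 0 by apply: vST; exists p, q.
rewrite /polyfun mevalM => /eqP; rewrite mulf_eq0 => /orP[pv0|/eqP//].
by rewrite /polyfun pv0 in pv.
Qed.

Lemma zariski_open_bigU (I : Type) (f : I -> set V) :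
  (forall i, zariski_open (f i)) -> zariski_open (\bigcup_i f i).
Proof.
move=> /choice[S SE]; exists (\bigcup_i S i).
rewrite setC_bigcup; apply/seteqP; split=> v vf.
  by move=> p [i _ Sp]; move: (vf i Logic.I); rewrite SE; apply.
by move=> i _; rewrite SE => p Sp; apply: vf; exists i.
Qed.

HB.instance Definition _ := @isOpenTopological.Build zariski zariski_open
  zariski_openT zariski_openI zariski_open_bigU.

Lemma zariski_closedP (A : set V) :
  closed (A : set zariski) <-> exists S, A = zero_locus S.
Proof.
rewrite -openC; split=> -[S SE]; exists S; last by rewrite setCK.
by rewrite -SE setCK.
Qed.

End Zariski.

Section LevelSets.
Variables (R : realType) (T : Type) (F : T -> R).

Definition sublevel (r : R) : set T := [set v | F v <= r].
Definition level (r : R) : set T := [set v | F v = r].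

End LevelSets.

Definition discrete_from_below (R : realType) (A : set R) : Prop :=
  forall u : nat -> R, (forall n, A (u n)) -> nondecreasing_seq u ->
    exists N : nat, forall n : nat, (N <= n)%N -> u n = u N.

(* Main.v *)
(* The condition (b) says that each [{F < r}] is Zariski-closed, which is immediate
   from (a). Conversely, along a non-decreasing sequence of values the sublevel sets
   increase to a closed set W: V itself, or [{F < r}] with r the supremum.
   A closed set W that is an increasing countable union of closed sets Z_n equals
   some Z_n: by Hilbert's basis theorem the sets W \ Z_n are constructible, and over
   an uncountable algebraically closed field a decreasing sequence of nonempty
   constructible sets has a common point. The coordinates of that point are chosen
   one at a time: by quantifier elimination, the admissible values of the next
   coordinate form a decreasing sequence of sets that are finite or cofinite. *)
Require Import Defs.
From mathcomp Require Import all_boot all_order all_algebra.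
From mathcomp Require Import complex.
From mathcomp Require Import classical_sets reals topology.
From mathcomp Require Import mpoly closed_field zify.
From mathcomp Require Import boolp cardinality.
From mathcomp Require lebesgue_measure.

Set Implicit Arguments.
Unset Strict Implicit.
Unset Printing Implicit Defensive.

Import Order.TTheory GRing.Theory Num.Theory.

Local Open Scope classical_set_scope.
Local Open Scope ring_scope.

(** * Noetherian rings and Hilbert's basis theorem *)

Section Ideals.
Variable R : comNzRingType.
Implicit Types (I S : set R) (s : seq R).

Definition is_ideal I : Prop :=
  [/\ I 0, forall x y, I x -> I y -> I (x + y) & forall a x, I x -> I (a * x)].

Definition ideal_gen S : set R :=
  [set x | forall I, is_ideal I -> S `<=` I -> I x].

Definition noetherian : Prop :=
  forall I, is_ideal I -> exists s, I = ideal_gen [set` s].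

Lemma ideal_gen_is_ideal S : is_ideal (ideal_gen S).
Proof.
split=> [I [] //|x y Sx Sy I Iid SI|a x Sx I Iid SI]; have [_ ID IM] := Iid.
- by apply: ID; [apply: Sx|apply: Sy].
- by apply: IM; apply: Sx.
Qed.

Lemma sub_ideal_gen S : S `<=` ideal_gen S.
Proof. by move=> x Sx I _ SI; apply: SI. Qed.

Lemma ideal_gen_min S I : is_ideal I -> S `<=` I -> ideal_gen S `<=` I.
Proof. by move=> Iid SI x Sx; apply: Sx. Qed.

Lemma ideal_genS S S' : S `<=` S' -> ideal_gen S `<=` ideal_gen S'.
Proof.
move=> SS'; apply: (ideal_gen_min (ideal_gen_is_ideal S')) => x Sx.
by apply: sub_ideal_gen; apply: SS'.
Qed.

Lemma is_ideal_sub I x y : is_ideal I -> I x -> I y -> I (x - y).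
Proof. by case=> _ ID IM Ix Iy; apply: ID => //; rewrite -mulN1r; apply: IM. Qed.

(** The ideals generated by the initial segments of [f] increase, so their union is an ideal. Its
    finitely many generators all lie in one stage, which therefore contains the next term. *)
Lemma noetherian_seq (f : nat -> R) :
  noetherian -> exists n, ideal_gen [set` mkseq f n] (f n).
Proof.
move=> noethR; pose A n := ideal_gen [set` mkseq f n].
have leA m n : (m <= n)%N -> A m `<=` A n.
  move=> lemn; apply: ideal_genS => _ /= /mapP[i im ->].
  apply: map_f; move: im; rewrite !mem_iota !add0n => /leq_trans; exact.
have Aid n : is_ideal (A n) by apply: ideal_gen_is_ideal.
have [|s sE] := noethR (\bigcup_n A n).
  split; first by exists 0%N => //; have [] := Aid 0%N.
  - move=> x y [m _ Ax] [n _ Ay]; exists (maxn m n) => //.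
    have [_ AD _] := Aid (maxn m n).
    by apply: AD; [apply: leA Ax; rewrite leq_maxl
                  |apply: leA Ay; rewrite leq_maxr].
  - by move=> a x [n _ Ax]; exists n => //; have [_ _ AM] := Aid n; apply: AM.
have [n sn] : exists n, [set` s] `<=` A n.
  have : [set` s] `<=` \bigcup_n A n by rewrite sE; apply: sub_ideal_gen.
  elim: s {sE} => [|x s IHs] sA; first by exists 0%N.
  have [|m sm] := IHs.
    by move=> y ys; apply: sA; rewrite /= inE (ys : y \in s) orbT.
  have [|n _ xn] := sA x; first by rewrite /= mem_head.
  exists (maxn m n) => y; rewrite /= inE => /predU1P[->|ys].
    by apply: leA xn; rewrite leq_maxr.
  by apply: leA (sm _ ys); rewrite leq_maxl.
exists n; apply: (ideal_gen_min (Aid n) sn); rewrite -sE.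
exists n.+1 => //; apply: sub_ideal_gen => /=; apply: map_f.
by rewrite mem_iota /= add0n.
Qed.

End Ideals.

(** The preimage of an ideal is an ideal, and by surjectivity the images of its generators generate
    the original one. *)
Lemma noetherian_surj (R R' : comNzRingType) (phi : {rmorphism R -> R'}) :
  (forall y, exists x, phi x = y) -> noetherian R -> noetherian R'.
Proof.
move=> surj noethR I Iid.
have preid J : is_ideal J -> is_ideal (phi @^-1` J).
  case=> J0 JD JM; split=> [|x y|a x]; rewrite /preimage /=.
  - by rewrite rmorph0.
  - by rewrite rmorphD; apply: JD.
  - by rewrite rmorphM; apply: JM.
have [s sE] := noethR _ (preid I Iid).
exists (map phi s); apply/seteqP; split.
  move=> y Iy J Jid sJ; have [x xy] := surj y.
  have : ideal_gen [set` s] x by rewrite -sE /preimage /= xy.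
  rewrite -xy; apply: (ideal_gen_min (preid J Jid)) => z zs.
  by apply: sJ; apply: map_f.
apply: (ideal_gen_min Iid) => _ /= /mapP[x xs ->].
have : ideal_gen [set` s] x by apply: sub_ideal_gen.
by rewrite -sE.
Qed.

Lemma field_noetherian (K : fieldType) : noetherian K.
Proof.
move=> I Iid; have [I0 ID IM] := Iid.
have [[x Ix xn0]|nI] := pselect (exists2 x, I x & x != 0).
  exists [:: x]; apply/seteqP; split=> y.
    move=> _ J [_ _ JM] xJ; rewrite -(divfK xn0 y); apply: JM; apply: xJ.
    by rewrite /= mem_head.
  by move=> _; rewrite -(divfK xn0 y); apply: IM.
exists [::]; apply/seteqP; split=> y.
  move=> Iy J [J0 _ _] _; have [-> //|yn0] := eqVneq y 0.
  by case: nI; exists y.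
by apply: (ideal_gen_min Iid).
Qed.

(* A sequence of elements of [I] of minimal size outside the ideal generated by
   the previous ones cannot continue forever: once a leading coefficient lies in
   the ideal generated by the previous ones, subtraction lowers the size. *)
Lemma poly_noetherian (R : comNzRingType) : noetherian R -> noetherian {poly R}.
Proof.
move=> noethR I Iid; apply: contrapT => /forallNP nfg.
(* The condition on [G] stands under the quantifier, so that choice yields a total function
   [next]. *)
have next_ex (G : seq {poly R}) : exists p, [set` G] `<=` I ->
    [/\ I p, ~ ideal_gen [set` G] p &
      forall q, I q -> ~ ideal_gen [set` G] q -> (size p <= size q)%N].
  have [GI|?] := pselect ([set` G] `<=` I); last by exists 0.
  pose P n := `[< exists p, [/\ I p, ~ ideal_gen [set` G] p & size p = n] >].
  have exP : exists n, P n.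
    have [p Ip Gp] : exists2 p, I p & ~ ideal_gen [set` G] p.
      apply: contrapT => nG; apply: (nfg G); apply/seteqP; split.
        by move=> p Ip; apply: contrapT => Gp; apply: nG; exists p.
      exact: ideal_gen_min.
    by exists (size p); apply/asboolP; exists p.
  case: (ex_minnP exP) => n /asboolP[p [Ip Gp <-]] pmin.
  exists p => _; split=> // q Iq Gq.
  by apply: pmin; apply/asboolP; exists q.
have [next nextP] := choice next_ex.
pose G := fix G n := if n is n'.+1 then rcons (G n') (next (G n')) else [::].
pose g n := next (G n).
have GE n : G n = mkseq g n.
  by elim: n => // n IHn; rewrite mkseqS -IHn.
have GI n : [set` G n] `<=` I.
  elim: n => //= n IHn p; rewrite /= mem_rcons inE => /predU1P[->|]; last exact: IHn.
  by have [] := nextP _ IHn.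
have leG m n : (m <= n)%N -> [set` G m] `<=` [set` G n].
  move=> lemn; rewrite !GE => _ /= /mapP[i im ->].
  by apply: map_f; move: im; rewrite !mem_iota !add0n => /leq_trans; apply.
have [n] := noetherian_seq (fun n => lead_coef (g n)) noethR.
have [In Gn gmin] := nextP _ (GI n); rewrite -/(g n) in In Gn gmin.
have Gid := ideal_gen_is_ideal [set` G n]; have [G0 GD GM] := Gid.
pose d := size (g n).
have gn0 : g n != 0 by apply/eqP => g0; apply: Gn; rewrite g0.
have d0 : (0 < d)%N by rewrite size_poly_gt0.
(* Bounding the size instead of fixing it keeps [J] closed under addition when top coefficients
   cancel. *)
pose J := [set a : R | exists q,
  [/\ ideal_gen [set` G n] q, (size q <= d)%N & q`_d.-1 = a]].
have Jid : is_ideal J.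
  split.
  - by exists 0; rewrite size_poly0 coef0.
  - move=> _ _ [p [Gp sp <-]] [q [Gq sq <-]]; exists (p + q).
    rewrite coefD; split=> //; first exact: GD.
    by rewrite (leq_trans (size_polyD _ _))// geq_max sp.
  - move=> a _ [p [Gp sp <-]]; exists (a%:P * p).
    rewrite coefCM; split=> //; first exact: GM.
    by rewrite mul_polyC (leq_trans (size_scale_leq _ _)).
case/(_ J Jid) => [_ /= /mapP[i /[!mem_iota]/= i_lt_n ->]|q [Gq sq qE]].
  have gi : g i \in G n by rewrite GE map_f// mem_iota.
  have [Ii Gi gimin] := nextP _ (GI i); rewrite -/(g i) in Ii Gi gimin.
  have gi0 : g i != 0.
    apply/eqP => g0; apply: Gi; rewrite g0.
    by have [] := ideal_gen_is_ideal [set` G i].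
  (* By monotonicity [g n] also lies outside the ideal of the shorter list [G i], so it competed in
     the minimal choice of [g i]. *)
  have sid : (size (g i) <= d)%N.
    by apply: gimin => // Gin; apply: Gn; apply: (ideal_genS _ Gin); apply: leG; apply: ltnW.
  (* The power of ['X] moves the leading coefficient of [g i] to degree [d.-1]. *)
  exists ('X^(d - size (g i)) * g i); split.
  - by apply: GM; apply: sub_ideal_gen.
  - by rewrite size_monicM ?monicXn// size_polyXn addSn /= subnK.
  - rewrite coefXnM ltn_subRL.
    have -> : (size (g i) + d.-1 < d)%N = false.
      by apply/negbTE; rewrite -leqNgt -{1}(prednK d0) -add1n leq_add2r size_poly_gt0.
    by rewrite /lead_coef; congr (_`_ _); lia.
have nG : ~ ideal_gen [set` G n] (g n - q).
  by move=> /(GD _ q) /(_ Gq); rewrite subrK.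
have Iq : I q by apply: ideal_gen_min Gq.
have := gmin _ (is_ideal_sub Iid In Iq) nG.
apply/negP; rewrite -ltnNge -/d -(prednK d0) ltnS.
apply/leq_sizeP => j; rewrite leq_eqVlt => /predU1P[<-|dj].
  by rewrite coefB qE /lead_coef subrr.
rewrite coefB !nth_default ?subrr//; last by rewrite -/d -(prednK d0).
by rewrite (leq_trans sq)// -(prednK d0).
Qed.

(** Induction on [n]: widening the coefficients and evaluating at the last variable maps [{poly
    {mpoly K[n]}}] onto [{mpoly K[n.+1]}]. Surjectivity is checked on monomials. *)
Lemma mpoly_noetherian (K : fieldType) n : noetherian {mpoly K[n]}.
Proof.
elim: n => [|n IHn].
  apply: (@noetherian_surj K _ (@mpolyC 0 K)) (@field_noetherian K) => p.
  exists p@_0; apply/mpolyP => m; rewrite mcoeffC.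
  by rewrite (_ : m = 0%MM) ?eqxx ?mulr1//; apply/mnmP => -[].
pose phi : {rmorphism {poly {mpoly K[n]}} -> {mpoly K[n.+1]}} :=
  horner_eval 'X_ord_max \o map_poly (@mwiden n K).
apply: (noetherian_surj (phi := phi)) (poly_noetherian IHn).
have phiM p q : (exists x, phi x = p) -> (exists x, phi x = q) ->
    exists x, phi x = p * q.
  by move=> [x <-] [y <-]; exists (x * y); rewrite rmorphM.
have phiC c : phi (c%:MP)%:P = c%:MP.
  by rewrite /= /horner_eval map_polyC hornerC /= mwidenC.
elim/mpolyind => [|c m p _ _ [x <-]]; first by exists 0; rewrite rmorph0.
have [y yE] : exists y, phi y = c *: 'X_[m].
  rewrite -mul_mpolyC; apply: (phiM); first by eexists; apply: phiC.
  rewrite mpolyXE_id; elim/big_ind: _ => [||i _].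
  - by exists 1; rewrite rmorph1.
  - exact: phiM.
  have [z zE] : exists z, phi z = 'X_i.
    (* The last variable comes from ['X], every other one from a constant polynomial. *)
    have [j ->|->] := unliftP ord_max i.
      exists ('X_j)%:P; rewrite /= /horner_eval map_polyC hornerC /= mwidenX.
      rewrite mnmwiden1; congr 'X_[U_(_)]; apply: val_inj.
      by rewrite /= /bump leqNgt ltn_ord.
    by exists 'X; rewrite /= /horner_eval map_polyX hornerX.
  by exists (z ^+ m i); rewrite rmorphXn /= -zE.
by exists (y + x); rewrite rmorphD yE.
Qed.

(** * Definable sets over an algebraically closed field, and saturation *)

Lemma poly_cofinite_root (K : closedFieldType) (p : {poly K}) :
  exists (s : seq K) (b : bool), forall x, x \notin s -> root p x = b.
Proof.
have [->|p0] := eqVneq p 0; first by exists [::], true => x _; rewrite root0.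
have [s pE] := closed_field_poly_normal p; exists s, false => x xs.
by rewrite pE rootZ ?lead_coef_eq0// root_prod_XsubC (negbTE xs).
Qed.

Section Definable.
Variable K : closedFieldType.
Implicit Types (f : GRing.formula K) (e : seq K).

(** An atom is a polynomial equation in the variable [i], and finite or cofinite sets are stable
    under Boolean operations; [b] is the truth value off the finite set [s]. *)
Lemma qf_cofinite f e i : GRing.qf_form f -> GRing.rformula f ->
  exists (s : seq K) (b : bool),
    forall x, x \notin s -> GRing.qf_eval (set_nth 0 e i x) f = b.
Proof.
elim: f => //=.
- by move=> b _ _; exists [::], b.
- move=> t1 t2 _ /andP[rt1 rt2].
  have [s [b sb]] := poly_cofinite_root
    (ClosedFieldQE.eval_poly e (ClosedFieldQE.abstrX i t1) -
     ClosedFieldQE.eval_poly e (ClosedFieldQE.abstrX i t2)).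
  exists s, b => x /sb <-.
  by rewrite rootE hornerD hornerN !ClosedFieldQE.abstrXP// subr_eq0.
- move=> f1 IH1 f2 IH2 /andP[q1 q2] /andP[r1 r2].
  have [[s1 [b1 h1]] [s2 [b2 h2]]] := (IH1 q1 r1, IH2 q2 r2).
  exists (s1 ++ s2), (b1 && b2) => x.
  by rewrite mem_cat negb_or => /andP[/h1 -> /h2 ->].
- move=> f1 IH1 f2 IH2 /andP[q1 q2] /andP[r1 r2].
  have [[s1 [b1 h1]] [s2 [b2 h2]]] := (IH1 q1 r1, IH2 q2 r2).
  exists (s1 ++ s2), (b1 || b2) => x.
  by rewrite mem_cat negb_or => /andP[/h1 -> /h2 ->].
- move=> f1 IH1 f2 IH2 /andP[q1 q2] /andP[r1 r2].
  have [[s1 [b1 h1]] [s2 [b2 h2]]] := (IH1 q1 r1, IH2 q2 r2).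
  exists (s1 ++ s2), (b1 ==> b2) => x.
  by rewrite mem_cat negb_or => /andP[/h1 -> /h2 ->].
- move=> f1 IH1 q1 r1; have [s1 [b1 h1]] := IH1 q1 r1.
  by exists s1, (~~ b1) => x /h1 ->.
Qed.

(** Quantifier elimination reduces this to the quantifier-free case. *)
Lemma definable_cofinite f e i : GRing.rformula f ->
  exists (s : seq K) (b : bool),
    forall x, x \notin s -> (GRing.holds (set_nth 0 e i x) f <-> b).
Proof.
move=> rf.
have wf := @ClosedFieldQE.wf_ex_elim K.
have ok := ClosedFieldQE.holds_ex_elim (@solve_monicpoly K).
have /andP[qf rf'] := GRing.quantifier_elim_wf wf rf.
have [s [b h]] := qf_cofinite e i qf rf'.
exists s, b => x /h <-.
exact: (rwP (GRing.quantifier_elim_rformP wf ok _ rf)).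
Qed.

Definition exists_vars (xs : seq nat) f : GRing.formula K :=
  foldr (@GRing.Exists K) f xs.

Lemma rformula_exists_vars xs f :
  GRing.rformula (exists_vars xs f) = GRing.rformula f.
Proof. by elim: xs. Qed.

Lemma exists_vars_mono xs f1 f2 :
  (forall e, GRing.holds e f1 -> GRing.holds e f2) ->
  forall e, GRing.holds e (exists_vars xs f1) -> GRing.holds e (exists_vars xs f2).
Proof. by move=> f12; elim: xs => //= i xs IHxs e [x /IHxs]; exists x. Qed.

(** The entries of [e'] serve as witnesses for the quantified variables. *)
Lemma holds_exists_vars xs f e e' :
  (forall i, i \notin xs -> e`_i = e'`_i) ->
  GRing.holds e' f -> GRing.holds e (exists_vars xs f).
Proof.
elim: xs e => [|i xs IHxs] e ee' fe'.
  by apply: GRing.eq_holds fe' => j; rewrite ee'.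
exists e'`_i; apply: IHxs fe' => j jxs; rewrite nth_set_nth /=.
by have [->//|ji] := eqVneq j i; rewrite ee'// inE negb_or ji.
Qed.

Section Saturation.
Hypothesis K_uncountable : forall E : nat -> seq K, exists x, forall n, x \notin E n.

(* Each condition defines a finite or a cofinite set of [x]: if one of them is
   finite, compactness applies, otherwise countably many points are excluded. *)
Lemma definable_inter (f : nat -> GRing.formula K) e i :
  (forall n, GRing.rformula (f n)) ->
  (forall n e', GRing.holds e' (f n.+1) -> GRing.holds e' (f n)) ->
  (forall n, exists x, GRing.holds (set_nth 0 e i x) (f n)) ->
  exists x, forall n, GRing.holds (set_nth 0 e i x) (f n).
Proof.
move=> rf fdec fex; pose S n x := GRing.holds (set_nth 0 e i x) (f n).
have Sdec m n x : (m <= n)%N -> S n x -> S m x.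
  by move=> /subnK <-; elim: (n - m)%N => //= k IHk /fdec.
have /choice[s /choice[b sb]] n := definable_cofinite e i (rf n).
have [[k bk]|nb] := pselect (exists k, ~~ b k).
  have Sk x : S k x -> x \in s k.
    by move=> Skx; apply: contraNT bk => /sb /iffLR; apply.
  apply: contrapT => /forallNP nS.
  (* Each of the finitely many candidates in [s k] fails from some stage on; the largest of these
     stages excludes them all. *)
  have [N NP] : exists N, forall x, x \in s k -> ~ S N x.
    elim: (s k) => [|y r [N NP]]; first by exists 0%N.
    have [M yM] : exists M, ~ S M y by apply/existsNP/nS.
    exists (maxn M N) => x; rewrite inE => /predU1P[->|/NP xN] Sx.
      by apply: yM; apply: Sdec Sx; rewrite leq_maxl.
    by apply: xN; apply: Sdec Sx; rewrite leq_maxr.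
  have [x Sx] := fex (maxn k N).
  apply: (NP x); first by apply: Sk; apply: Sdec Sx; rewrite leq_maxl.
  by apply: Sdec Sx; rewrite leq_maxr.
have [x xs] := K_uncountable s.
exists x => n; apply/(sb n x (xs n)).
by apply: contrapT => /negP bn; apply: nb; exists n.
Qed.

(** Induction on the variables: [definable_inter] fixes the outermost one so that all the remaining
    existential formulas still hold. *)
Lemma definable_saturation (f : nat -> GRing.formula K) xs e :
  (forall n, GRing.rformula (f n)) ->
  (forall n e', GRing.holds e' (f n.+1) -> GRing.holds e' (f n)) ->
  (forall n, GRing.holds e (exists_vars xs (f n))) ->
  exists e', forall n, GRing.holds e' (f n).
Proof.
move=> rf fdec; elim: xs e => [|i xs IHxs] e fe; first by exists e.
have [||//|x /IHxs//] := @definable_inter (fun n => exists_vars xs (f n)) e i.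
- by move=> n; rewrite rformula_exists_vars.
- by move=> n e1; apply: exists_vars_mono => e2; apply: fdec.
Qed.

End Saturation.

Lemma mpoly_term n (p : {mpoly K[n]}) : exists t : GRing.term K,
  GRing.rterm t /\ forall e, GRing.eval e t = p.@[fun i => e`_i].
Proof.
elim/mpolyind: p => [|c m p _ _ [t [rt tE]]].
  by exists (GRing.Const 0); split=> // e; rewrite /= meval0.
have [t' [rt' tE']] : exists t : GRing.term K,
    GRing.rterm t /\ forall e, GRing.eval e t = 'X_[m].@[fun i : 'I_n => e`_i].
  have [u [ru uE]] : exists u : GRing.term K, GRing.rterm u /\
      forall e, GRing.eval e u = \prod_(i <- enum 'I_n) e`_i ^+ m i.
    elim: (enum 'I_n) => [|i r [u [ru uE]]].
      by exists (GRing.Const 1); split=> // e; rewrite big_nil.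
    exists (GRing.Mul (GRing.Exp (GRing.Var K i) (m i)) u); split=> // e.
    by rewrite big_cons /= uE.
  by exists u; split=> // e; rewrite mevalX uE big_enum.
exists (GRing.Add (GRing.Mul (GRing.Const c) t') t); split=> /= [|e].
  by rewrite rt'.
by rewrite mevalD mevalZ tE tE'.
Qed.

Lemma mpoly_zeros_formula n (s : seq {mpoly K[n]}) : exists f,
  GRing.rformula f /\
  forall e, GRing.holds e f <-> forall p, p \in s -> p.@[fun i => e`_i] = 0.
Proof.
elim: s => [|p s [f [rf fE]]]; first by exists (GRing.Bool true).
have [t [rt tE]] := mpoly_term p.
exists (GRing.And (GRing.Equal t (GRing.Const 0)) f); split=> /= [|e].
  by rewrite rt.
rewrite tE; split=> [[p0 /fE fs] q|ps].
  by rewrite inE => /predU1P[->//|/fs].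
split; first by rewrite ps ?mem_head.
by apply/fE => q qs; rewrite ps// inE qs orbT.
Qed.

End Definable.

(** * Zariski-closed sets over an uncountable algebraically closed field *)

Section ZariskiClosed.
Variables (K : closedFieldType) (V : vectType K).

(** The polynomials vanishing at a point form an ideal, so a set and any generators of its ideal
    have the same zeros. Finiteness lets a single formula express the locus. *)
Lemma zero_locus_finite (S : set {mpoly K[\dim {:V}]}) :
  exists s : seq _, zero_locus S = zero_locus [set` s] :> set V.
Proof.
have [s sE] := mpoly_noetherian (ideal_gen_is_ideal S).
have vanish_ideal (v : V) : is_ideal [set p | polyfun p v = 0 :> K].
  split=> [|p q|a p]; rewrite /= /polyfun.
  - by rewrite meval0.
  - by rewrite mevalD => -> ->; rewrite addr0.
  - by rewrite mevalM => ->; rewrite mulr0.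
exists s; apply/seteqP; split=> v Sv p ps.
  have : ideal_gen S p by rewrite sE; apply: sub_ideal_gen.
  exact: (ideal_gen_min (vanish_ideal v) Sv).
have : ideal_gen [set` s] p by rewrite -sE; apply: sub_ideal_gen.
exact: (ideal_gen_min (vanish_ideal v) Sv).
Qed.

(** Environments of formulas serve as coordinate lists: missing entries read as 0 and entries beyond
    the dimension are ignored. *)
Let vec_of (e : seq K) : V := \sum_(i < \dim {:V}) e`_i *: (vbasis {:V})`_i.

Let coords (v : V) : seq K := mkseq
  (fun i => if insub i is Some j then coord (vbasis {:V}) j v else 0) (\dim {:V}).

Let coordsK v : vec_of (coords v) = v.
Proof.
rewrite [RHS](coord_vbasis (memvf v)); apply: eq_bigr => i _.
by rewrite nth_mkseq// valK.
Qed.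

Lemma closed_formula (Z : set V) : closed (Z : set (zariski V)) ->
  exists f, GRing.rformula f /\ forall e, GRing.holds e f <-> Z (vec_of e).
Proof.
move=> /zariski_closedP[S ->]; have [s ->] := zero_locus_finite S.
have [f [rf fE]] := mpoly_zeros_formula s; exists f; split=> // e; rewrite fE.
have polyE p : polyfun p (vec_of e) = p.@[fun i => e`_i].
  apply: meval_eq => i; rewrite coord_sum_free//.
  exact: basis_free (vbasisP _).
by split=> h p /h; rewrite polyE.
Qed.

(** If no [Z n] exhausts the union, the formulas [f n] define the differences, which are nonempty
    and decreasing; saturation then gives a point of the union outside every [Z n]. *)
Lemma closed_bigcup_stationary (Z : nat -> set V) :
  (forall E : nat -> seq K, exists x, forall n, x \notin E n) ->
  (forall n, closed (Z n : set (zariski V))) ->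
  (forall n, Z n `<=` Z n.+1) ->
  closed (\bigcup_n Z n : set (zariski V)) ->
  exists n, \bigcup_n Z n `<=` Z n.
Proof.
move=> unc Zcl Zmono Wcl; apply: contrapT => /forallNP nZ.
have [g [rg gE]] := closed_formula Wcl.
have /choice[h hP] n := closed_formula (Zcl n).
pose f n := GRing.And g (GRing.Not (h n)).
have fE n e : GRing.holds e (f n) <-> (\bigcup_n Z n `\` Z n) (vec_of e).
  by rewrite /= gE; have [_ ->] := hP n.
have [|n e|n|e fe] := @definable_saturation K unc f (iota 0 (\dim {:V})) [::].
- by move=> n; rewrite /= rg; have [] := hP n.
- by rewrite !fE => -[We Ze]; split=> // Zne; apply/Ze/Zmono.
- have [v [Wv Zv]] : exists v, (\bigcup_n Z n `\` Z n) v.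
    apply: contrapT => /forallNP nv; apply: (nZ n) => v Wv.
    by apply: contrapT => Zv; apply: (nv v).
  (* From index [\dim {:V}] on, both environments read the default 0. *)
  apply: (@holds_exists_vars _ _ _ _ (coords v)).
    move=> i; rewrite mem_iota add0n /= -leqNgt => lei.
    by rewrite nth_nil nth_default// size_mkseq.
  by apply/fE; rewrite coordsK.
have [[n _ Zn] _] := (fE 0%N e).1 (fe 0%N).
by have [_] := (fE n e).1 (fe n).
Qed.

End ZariskiClosed.

(** The real parts of the listed points form a countable set, which cannot contain the interval from
    0 to 1, of Lebesgue measure 1. *)
Lemma complex_uncountable (R : realType) (E : nat -> seq (complex R)) :
  exists x, forall n, x \notin E n.
Proof.
pose A : set R := \bigcup_n [set` map (@complex.Re R) (E n)].
have cA : countable A.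
  by apply: bigcup_countable => // n _; apply: finite_set_countable.
have [x xA] : exists x, ~ A x.
  apply: contrapT => /forallNP nA.
  have cI : countable [set` `[0 : R, 1]].
    by apply: sub_countable cA; apply: subset_card_le => x _; apply: contrapT => /nA.
  have := lebesgue_measure.countable_lebesgue_measure0 cI.
  rewrite lebesgue_measure.lebesgue_measure_itv /=.
  rewrite constructive_ereal.lte_fin ltr01 => -[/eqP].
  by rewrite subr0 oner_eq0.
exists (x%:C)%C => n; apply/negP => xE; apply: xA; exists n => //=.
by apply/mapP; exists (x%:C)%C.
Qed.

(** * Discreteness of the values and openness of the level sets *)

Theorem theorem4p6 (R : realType) (V : vectType (complex R)) (F : V -> R)
    (Fclosed : forall r : R, closed (sublevel F r : set (zariski V))) :
  discrete_from_below (range F) <->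
  (forall r : R,
     open (level F r : set (subspace (sublevel F r : set (zariski V))))).
Proof.
(* As the sublevel set is closed in [V], closedness relative to it is closedness in [V]; this is
   applied to the complement of the level set. *)
have openE r : open (level F r : set (subspace (sublevel F r : set (zariski V))))
    <-> closed ([set v | F v < r] : set (zariski V)).
  rewrite open_subspaceP; split=> [[U oU UE]|cl].
    rewrite (_ : [set v | F v < r] = sublevel F r `&` ~` U).
      by apply: closedI => //; apply: open_closedC.
    have UEv v : (U v /\ F v <= r) <-> F v = r.
      have /seteqP[/(_ v) h1 /(_ v) h2] := UE.
      split=> [/h1[]//|Fv]; apply: h2; split=> //.
      by rewrite /sublevel /= Fv.
    apply/seteqP; split=> v /=.
      move=> Fr; split; first exact: ltW.
      move=> Uv; have : F v = r by apply/UEv; split=> //; apply: ltW.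
      by move=> Fvr; rewrite Fvr ltxx in Fr.
    move=> [Fr nU]; rewrite lt_neqAle [F v <= r]Fr andbT.
    by apply/eqP => /UEv[].
  exists (~` [set v | F v < r]); first exact: closed_openC.
  apply/seteqP; split=> v [/= h1 h2]; split=> //.
    by apply/eqP; rewrite eq_le [F v <= r]h2 leNgt; apply/negP.
  by rewrite (h1 : F v = r) ltxx.
split=> [disc r|cl].
  apply/openE; have [[v0 v0r]|nv] := pselect (exists v, F v < r); last first.
    rewrite (_ : [set v | _] = set0); first exact: closed0.
    by apply/seteqP; split=> // v vr; apply: nv; exists v.
  (* A largest value below [r] turns [{F < r}] into a sublevel set, closed by hypothesis. *)
  suff [v vr vmax] : exists2 v, F v < r & forall w, F w < r -> F w <= F v.
    rewrite (_ : [set v | F v < r] = sublevel F (F v)) //.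
    by apply/seteqP; split=> w /=; [exact: vmax|move=> /le_lt_trans; apply].
  apply: contrapT => nmax.
  have next v : exists w, F v < r -> F v < F w < r.
    have [vr|] := pselect (F v < r); last by exists v.
    apply: contrapT => /forallNP nw; apply: nmax; exists v => // w wr.
    rewrite leNgt; apply/negP => vw; apply: (nw w) => _.
    by rewrite vw.
  have [g gP] := choice next.
  (* Without a largest value, iterating [g] gives strictly increasing values below [r], against
     discreteness. *)
  pose w n := iter n g v0.
  have wr n : F (w n) < r by elim: n => //= n /gP /andP[].
  have wlt n : F (w n) < F (w n.+1) by have /andP[] := gP _ (wr n).
  have [||N] := disc (F \o w).
  - by move=> n; exists (w n).
  - by apply/sequences.nondecreasing_seqP => n; apply: ltW; apply: wlt.
  move=> /(_ N.+1 (leqnSn N)) /= wN.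
  by have := wlt N; rewrite /= wN ltxx.
move=> u uF umono.
have [N NP] : exists n, \bigcup_n sublevel F (u n) `<=` sublevel F (u n).
  apply: closed_bigcup_stationary => //.
  - exact: complex_uncountable.
  - by move=> n v /le_trans; apply; apply: umono.
  (* The union is closed in each of three cases: it is [V] if [u] is unbounded, a sublevel set if
     [u] attains its maximum, and otherwise [{F < r}] with [r] the supremum. *)
  have [ub|nub] := pselect (has_ubound (range u)); last first.
    rewrite (_ : \bigcup_n _ = setT); first exact: closedT.
    apply/seteqP; split=> // v _; apply: contrapT => nv; apply: nub.
    exists (F v) => _ [n _ <-]; rewrite leNgt; apply/negP => vn.
    by apply: nv; exists n => //; apply: ltW.
  have [[N NP]|nN] := pselect (exists N, forall n, u n <= u N).
    rewrite (_ : \bigcup_n _ = sublevel F (u N)) //.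
    by apply/seteqP; split=> v => [[n _ /le_trans]|]; [apply|exists N].
  rewrite (_ : \bigcup_n _ = [set v | F v < sup (range u)]).
    exact/openE.
  have supu : has_sup (range u) by split=> //; exists (u 0%N), 0%N.
  apply/seteqP; split=> v /=.
    move=> [n _ vn]; have [m nm] : exists m, u n < u m.
      apply: contrapT => /forallNP nm; apply: nN; exists n => m.
      by rewrite leNgt; apply/negP.
    apply: (le_lt_trans vn); apply: (lt_le_trans nm).
    by apply: ub_le_sup => //; exists m.
  (* The gap between the supremum and [F v] is the margin that yields a term of [u] above [F v]. *)
  rewrite -subr_gt0 => e0.
  have [_ [n _ <-]] := sup_adherent e0 supu.
  by rewrite subKr => /ltW; exists n.
exists N => n Nn; apply: le_anti; rewrite (umono _ _ Nn) andbT.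
(* Since [u n] is a value of [F], the inclusion of sublevel sets bounds it by [u N]. *)
have [v _ vE] := uF n.
by rewrite -vE; apply: NP; exists n => //; rewrite /sublevel /= vE.
Qed.
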